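(* Let $M^{Q}(n,m)$ be the number of Motzkin paths from $(0,0)$ to $(n,m)$ that avoid flat steps at odd indices, and let $$q_1=-\frac{x-\sqrt{4+x^2}+\sqrt{4-14x^2-2x\sqrt{4+x^2}}}{4x},\qquad q_2=-\frac{x+\sqrt{4+x^2}-\sqrt{4-14x^2+2x\sqrt{4+x^2}}}{4x}.$$ Then $$\sum_{n\ge0}\sum_{m\ge0}M^{Q}(n,m)x^ny^m=\frac{x(q_1-y)(q_2-y)+q_1q_2y-x^2(q_1+q_2-y+q_1q_2y)(1+y+y^2)}{x(1-q_1q_2)\big(y^2-x^2(1+y^2)(1+y+y^2)\big)},$$ and the generating function of such paths terminating on the $x$-axis is $$\sum_{n\ge0}M^{Q}(n,0)x^n=\frac{x(q_1+q_2)-q_1q_2}{x^2(1-q_1q_2)}.$$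
   Context: A lattice path is a finite sequence of steps (vectors in $\mathbb{Z}^2$) starting at $(0,0)$; its vertices are the partial sums. A Motzkin path is a lattice path with steps in $\{(1,0),(1,1),(1,-1)\}$ all of whose vertices have $y\ge0$; $(1,0)$ is the flat step. The steps of a path of $L$ steps are indexed $e_0,\dots,e_{L-1}$, and ''avoids flat steps at odd indices'' means $e_i\neq(1,0)$ for every odd $i$. *)

(* Defs.v *)
From HB Require Import structures.
From mathcomp Require Import all_boot all_order all_algebra.
From mathcomp Require Import boolp classical_sets.

Set Implicit Arguments.
Unset Strict Implicit.
Unset Printing Implicit Defensive.

Import Order.TTheory GRing.Theory Num.Theory.
Local Open Scope ring_scope.

Record fps (R : Type) := Fps { coefs : nat -> R }.

HB.instance Definition _ (R : Type) := gen_eqMixin (fps R).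
HB.instance Definition _ (R : Type) := gen_choiceMixin (fps R).

Lemma fpsP (R : Type) (f g : fps R) : (forall n, coefs f n = coefs g n) -> f = g.
Proof. by case: f g => [f] [g] /= /funext ->. Qed.

Section FpsRing.
Variable R : comNzRingType.
Implicit Types f g h : fps R.

Definition fps_add f g : fps R := Fps (fun n => coefs f n + coefs g n).
Definition fps_opp f : fps R := Fps (fun n => - coefs f n).
Definition fpsC (c : R) : fps R := Fps (fun n => if n == 0%N then c else 0).
Definition fps_mul f g : fps R :=
  Fps (fun n => \sum_(i < n.+1) coefs f i * coefs g (n - i)%N).

Fact fps_addA : associative fps_add.
Proof. by move=> f g h; apply: fpsP => n /=; rewrite addrA. Qed.
Fact fps_addC : commutative fps_add.
Proof. by move=> f g; apply: fpsP => n /=; rewrite addrC. Qed.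
Fact fps_add0 : left_id (fpsC 0) fps_add.
Proof. by move=> f; apply: fpsP => n /=; rewrite if_same add0r. Qed.
Fact fps_addN : left_inverse (fpsC 0) fps_opp fps_add.
Proof. by move=> f; apply: fpsP => n /=; rewrite if_same addNr. Qed.

HB.instance Definition _ :=
  GRing.isZmodule.Build (fps R) fps_addA fps_addC fps_add0 fps_addN.

(* The first [m] coefficients of a series, as a polynomial; only used to
   transfer the ring axioms. *)
Let tr m f : {poly R} := \poly_(i < m) coefs f i.

Let coef_trM m f g n : (n < m)%N -> coefs (fps_mul f g) n = (tr m f * tr m g)`_n.
Proof.
move=> ltnm; rewrite coefM /=; apply: eq_bigr => i _.
have lei : (i <= n)%N by rewrite -ltnS ltn_ord.
by rewrite !coef_poly (leq_ltn_trans lei ltnm)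
   (leq_ltn_trans (leq_subr _ _) ltnm).
Qed.

Let eq_coefM (p q r : {poly R}) n :
  (forall i, (i <= n)%N -> p`_i = q`_i) -> (p * r)`_n = (q * r)`_n.
Proof.
move=> pq; rewrite !coefM; apply: eq_bigr => i _.
by rewrite pq // -ltnS ltn_ord.
Qed.

Let trM m f g n : (n < m)%N -> (tr m (fps_mul f g))`_n = (tr m f * tr m g)`_n.
Proof. by move=> nm; rewrite coef_poly nm (coef_trM _ _ nm). Qed.

Fact fps_mulC : commutative fps_mul.
Proof.
by move=> f g; apply: fpsP => n; rewrite !(@coef_trM n.+1) // mulrC.
Qed.

Fact fps_mulA : associative fps_mul.
Proof.
move=> f g h; apply: fpsP => n; rewrite !(@coef_trM n.+1) //.
have trE u v i : (i <= n)%N ->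
    (tr n.+1 (fps_mul u v))`_i = (tr n.+1 u * tr n.+1 v)`_i.
  by move=> lein; rewrite trM // ltnS.
by rewrite mulrC (eq_coefM _ (trE g h)) (eq_coefM _ (trE f g)) mulrC mulrA.
Qed.

Fact fps_mul1 : left_id (fpsC 1) fps_mul.
Proof.
move=> f; apply: fpsP => n /=.
rewrite big_ord_recl /= mul1r subn0 big1 ?addr0 // => i _.
by rewrite mul0r.
Qed.

Fact fps_mulDl : left_distributive fps_mul fps_add.
Proof.
move=> f g h; apply: fpsP => n /=; rewrite -big_split /=.
by apply: eq_bigr => i _; rewrite mulrDl.
Qed.

Fact fps_oner_neq0 : fpsC 1 != fpsC 0.
Proof.
by apply/eqP => /(congr1 (fun f => coefs f 0%N)) /= /eqP; rewrite oner_eq0.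
Qed.

HB.instance Definition _ := GRing.Zmodule_isComNzRing.Build (fps R)
  fps_mulA fps_mulC fps_mul1 fps_mulDl fps_oner_neq0.

Definition fpsX : fps R := Fps (fun n => (n == 1%N)%:R).

Lemma coefs0 n : coefs (0 : fps R) n = 0.
Proof. by rewrite /= if_same. Qed.
Lemma coefs1 n : coefs (1 : fps R) n = (n == 0%N)%:R.
Proof. by case: n. Qed.
Lemma coefsD f g n : coefs (f + g) n = coefs f n + coefs g n.
Proof. by []. Qed.
Lemma coefsN f n : coefs (- f) n = - coefs f n.
Proof. by []. Qed.
Lemma coefsM f g n :
  coefs (f * g) n = \sum_(i < n.+1) coefs f i * coefs g (n - i)%N.
Proof. by []. Qed.

Fact fpsC_is_zmod_morphism : zmod_morphism fpsC.
Proof. by move=> a b; apply: fpsP => -[|n] //=; rewrite subrr. Qed.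
Fact fpsC_is_monoid_morphism : monoid_morphism fpsC.
Proof.
split=> // a b; apply: fpsP => n; rewrite coefsM big_ord_recl /= subn0.
rewrite big1 ?addr0; last by move=> i _; rewrite mul0r.
by case: n => //= n; rewrite mulr0.
Qed.
HB.instance Definition _ :=
  GRing.isZmodMorphism.Build R (fps R) fpsC fpsC_is_zmod_morphism.
HB.instance Definition _ :=
  GRing.isMonoidMorphism.Build R (fps R) fpsC fpsC_is_monoid_morphism.

Lemma fpsC_inj : injective fpsC.
Proof. by move=> a b /(congr1 (fun f => coefs f 0%N)). Qed.

Let has_inv f := exists g, g * f = 1.
Definition fps_unit : pred (fps R) := fun f => `[< has_inv f >].
Definition fps_inv f : fps R :=
  if pselect (has_inv f) is left fV then sval (cid fV) else f.

Fact fps_mulV : {in fps_unit, left_inverse 1 fps_inv *%R}.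
Proof.
move=> f /asboolP fU; rewrite /fps_inv; case: pselect => // fV.
exact: svalP (cid fV).
Qed.
Fact fps_unitP f g : g * f = 1 -> fps_unit f.
Proof. by move=> gf; apply/asboolP; exists g. Qed.
Fact fps_inv_out : {in [predC fps_unit], fps_inv =1 id}.
Proof. by move=> f /asboolPn fU; rewrite /fps_inv; case: pselect. Qed.

HB.instance Definition _ := GRing.ComNzRing_hasMulInverse.Build (fps R)
  fps_mulV fps_unitP fps_inv_out.

End FpsRing.

Section FpsIdomain.
Variable R : idomainType.

Let fps_order (f : fps R) : f != 0 ->
  exists2 k, coefs f k != 0 & forall i, (i < k)%N -> coefs f i = 0.
Proof.
move=> fN0; have exk : exists k, coefs f k != 0.
  apply: contrapT => nk; case/eqP: fN0; apply: fpsP => n.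
  by rewrite coefs0; apply/eqP/negPn/negP => fn; apply: nk; exists n.
case: (ex_minnP exk) => k fk mink; exists k => // i ltik; apply/eqP.
by apply: contraLR ltik; rewrite -leqNgt => /mink.
Qed.

Fact fps_idomain : GRing.integral_domain_axiom (fps R).
Proof.
move=> f g fg0; apply/norP => -[/fps_order [k fk fk0] /fps_order [l gl gl0]].
have /(congr1 (fun h => coefs h (k + l)%N)) := fg0.
rewrite coefsM coefs0 (bigD1 (Ordinal (leq_addr l k : (k < (k + l).+1)%N))) //=.
rewrite addKn big1 ?addr0; last first.
  move=> i /eqP/val_eqP /= nik; case: (ltngtP i k) nik => // [ltik|ltki] _.
    by rewrite fk0 // mul0r.
  rewrite gl0 ?mulr0 // ltn_subLR ?ltn_add2r //.
  by rewrite -ltnS.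
by move/eqP; rewrite mulf_eq0 (negPf fk) (negPf gl).
Qed.

HB.instance Definition _ :=
  GRing.ComUnitRing_isIntegral.Build (fps R) fps_idomain.
End FpsIdomain.

(* The square root with positive constant term: [sqrt (4 + ...)] stands for
   [2 + ...]. Junk value [0] if there is none. *)
Definition fps_sqrt (R : numFieldType) (f : fps R) : fps R :=
  xget 0 [set s : fps R | s ^+ 2 = f /\ 0 < coefs s 0].

Section FpsSqrt.
Variables (R : numFieldType) (f : fps R) (c : R).
Hypotheses (c_gt0 : 0 < c) (f0 : coefs f 0 = c ^+ 2).

Fixpoint sqrt_coefs n : seq R :=
  if n is n'.+1 then
    let s := sqrt_coefs n' in
    rcons s ((coefs f n - \sum_(i < n') s`_i.+1 * s`_(n' - i)) / (c *+ 2))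
  else [:: c].

Let sz n : size (sqrt_coefs n) = n.+1.
Proof. by elim: n => //= n IHn; rewrite size_rcons IHn. Qed.

Let stable n i : (i <= n)%N -> (sqrt_coefs n)`_i = (sqrt_coefs i)`_i.
Proof.
elim: n => [|n IHn]; first by rewrite leqn0 => /eqP ->.
rewrite leq_eqVlt => /predU1P[-> //|ltin].
by rewrite /= nth_rcons sz ltin IHn.
Qed.

Lemma fps_sqrt_exists : exists2 s : fps R, s ^+ 2 = f & coefs s 0 = c.
Proof.
exists (Fps (fun n => (sqrt_coefs n)`_n)) => //; apply: fpsP => n.
rewrite expr2 coefsM; case: n => [|n].
  by rewrite big_ord1 /= f0 expr2.
rewrite big_ord_recl big_ord_recr /= subn0 subnn !nth_rcons sz ltnn eqxx /=.
set S := \sum_(i < n) _; set T := \sum_(i < n) _.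
suff -> : T = S.
  have cN0 : c *+ 2 != 0 by rewrite mulrn_eq0 /= gt_eqF.
  rewrite [_ * c]mulrC addrCA -mulr2n -mulrnAl mulrC divfK //.
  by rewrite addrC subrK.
apply: eq_bigr => i _; have lti := ltn_ord i.
have -> : (sqrt_coefs n)`_i.+1 = (sqrt_coefs i.+1)`_i.+1 by apply: stable.
by rewrite /= /bump leq0n !add1n add0n subSS (stable (leq_subr i n)).
Qed.

Lemma fps_sqrtP : fps_sqrt f ^+ 2 = f /\ coefs (fps_sqrt f) 0 = c.
Proof.
have [s sf s0] := fps_sqrt_exists.
rewrite /fps_sqrt; case: xgetP => [t _ [tf t0]|/(_ s)]; last first.
  by case; split=> //; rewrite s0.
split=> //; have /eqP := tf; rewrite -sf eqf_sqr => /orP[/eqP -> //|/eqP ts].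
by move: t0; rewrite ts coefsN s0 oppr_gt0 => /(lt_trans c_gt0); rewrite ltxx.
Qed.

End FpsSqrt.

Definition lattice_path := seq (int * int).

Definition vertex (p : lattice_path) (k : nat) : int * int :=
  \sum_(e <- take k p) e.

Definition endpoint (p : lattice_path) : int * int := vertex p (size p).

Definition flat_step : int * int := (1, 0).
Definition motzkin_steps : seq (int * int) := [:: (1, 0); (1, 1); (1, -1)].

Definition is_motzkin (p : lattice_path) : bool :=
  all (fun e => e \in motzkin_steps) p
  && all (fun k => 0 <= (vertex p k).2) (iota 0 (size p).+1).

Definition avoids_odd_flat (p : lattice_path) : bool :=
  all (fun i => odd i ==> (nth 0 p i != flat_step)) (iota 0 (size p)).

Definition is_MQ_path (n m : nat) (p : lattice_path) : bool :=
  [&& is_motzkin p, endpoint p == (n%:Z, m%:Z) & avoids_odd_flat p].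

(* Every Motzkin step has abscissa 1, so a path ending at [(n, m)] has [n]
   steps and it is enough to count [n]-tuples: see [MQP]. *)
Definition MQ (n m : nat) : nat :=
  #|[set p : n.-tuple (seq_sub motzkin_steps)
      | is_MQ_path n m [seq val e | e <- p]]|.

Lemma is_MQ_path_size n m p : is_MQ_path n m p -> size p = n.
Proof.
case/and3P => /andP[/allP pM _] /eqP /(congr1 fst) + _.
rewrite /endpoint /vertex take_size /= => e1.
suff sz : (\sum_(e <- p) e).1 = (size p)%:Z by move: e1; rewrite sz => -[].
elim: p pM {e1} => [|e p IHp] pM; first by rewrite big_nil.
rewrite big_cons /= IHp; last by move=> z zp; apply: pM; rewrite inE zp orbT.
have /pM : e \in e :: p by rewrite inE eqxx.
by rewrite !inE => /or3P[] /eqP ->.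
Qed.

Lemma MQP n m : exists s : seq lattice_path,
  [/\ uniq s, forall p, (p \in s) = is_MQ_path n m p & size s = MQ n m].
Proof.
pose A := [set p : n.-tuple (seq_sub motzkin_steps)
      | is_MQ_path n m [seq val e | e <- p]].
pose v (p : n.-tuple (seq_sub motzkin_steps)) : lattice_path :=
  [seq val e | e <- p].
exists [seq v p | p <- enum A]; split; last by rewrite size_map -cardE.
- rewrite map_inj_uniq ?enum_uniq // => p q /(inj_map val_inj).
  exact: val_inj.
- move=> p; apply/mapP/idP => [[t + ->]|pP]; first by rewrite mem_enum inE.
  have szp := is_MQ_path_size pP; have /and3P[/andP[/allP pM _] _ _] := pP.
  have [t vt] : exists t : seq (seq_sub motzkin_steps), map val t = p.
    elim: p pM {pP szp} => [|e p IHp] pM; first by exists [::].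
    have [|t vt] := IHp; first by move=> z zp; apply: pM; rewrite inE zp orbT.
    have eM : e \in motzkin_steps by apply: pM; rewrite inE eqxx.
    by exists (SeqSub eM :: t); rewrite /= vt.
  have szt : size t == n by rewrite -szp -vt size_map.
  by exists (Tuple szt); rewrite ?mem_enum ?inE /v /= vt.
Qed.

(* [fps (fps rat)] is Q[[x]][[y]]: the outer variable is [y]. The identities
   live in its fraction field, since 1/x and the inverse of
   [y^2 - x^2(1+y^2)(1+y+y^2)] are not power series. *)
Definition gfield := {fraction fps (fps rat)}.

Definition gf_of_xy (g : fps (fps rat)) : gfield := FracField.tofrac g.
Definition gf_of_x (f : fps rat) : gfield := gf_of_xy (fpsC f).

Lemma gf_of_xy_inj : injective gf_of_xy.
Proof. by move=> f g /eqP; rewrite tofrac_eq => /eqP. Qed.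
Lemma gf_of_x_inj : injective gf_of_x.
Proof. by move=> f g /gf_of_xy_inj /fpsC_inj. Qed.

Definition gfx : gfield := gf_of_x (fpsX rat).
Definition gfy : gfield := gf_of_xy (fpsX (fps rat)).

(* sum_{n,m} MQ(n,m) x^n y^m: the coefficient of y^m is sum_n MQ(n,m) x^n. *)
Definition MQ_gf : gfield :=
  gf_of_xy (Fps (fun m => Fps (fun n => (MQ n m)%:R))).

Definition MQ_axis_gf : gfield := gf_of_x (Fps (fun n => (MQ n 0)%:R)).

(* Main.v *)
Require Import Defs.
From mathcomp Require Import all_boot all_order all_algebra.
From mathcomp Require Import ring zify.
Import Order.TTheory GRing.Theory Num.Theory.
Local Open Scope ring_scope.

(** Let [E] and [O] be the generating functions of the paths of even and odd
    length. Removing the last step gives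
      [y E = y + x (1 + y^2) O - x O_0],  [y O = x (1 + y + y^2) E - x E_0],
    a system with a unique power series solution since both equations gain a
    factor [x]. The series [q1 = x u1] and [q2 = x u2] are the small roots of
    the kernel [y^2 - x^2 (1 + y^2) (1 + y + y^2)], so that, with [S = q1 + q2]
    and [Q = q1 q2],
      [S + Q + Q S = 0]  and  [- Q = x^2 ((1 - Q)^2 + S^2)].
    These two relations suffice to check that
      [E = c / ((1 - q1 y) (1 - q2 y))],  [O = x (1 + S + (1 - Q) y) E],
    where [c = - u1 u2 / (1 - Q)], solve the system. *)

(** * Multiplication by the variable, and invertible power series *)

Section FpsExtra.
Variable R : comUnitRingType.
Implicit Types f g : fps R.

Lemma coefs_fpsXM0 f : coefs (fpsX R * f) 0 = 0.
Proof. by rewrite coefsM big_ord1 mul0r. Qed.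

Lemma coefs_fpsXMS f n : coefs (fpsX R * f) n.+1 = coefs f n.
Proof.
rewrite coefsM !big_ord_recl /= mul0r add0r mul1r subn1 big1 ?addr0 // => i _.
by rewrite mul0r.
Qed.

Lemma coefs_fpsCM (a : R) f n : coefs (fpsC a * f) n = a * coefs f n.
Proof.
rewrite coefsM big_ord_recl /= subn0 big1 ?addr0 // => i _.
by rewrite mul0r.
Qed.

Lemma coefsM0 f g : coefs (f * g) 0 = coefs f 0 * coefs g 0.
Proof. by rewrite coefsM big_ord1. Qed.

Lemma fpsX_neq0 : fpsX R != 0.
Proof.
by apply/eqP => /(congr1 (fun f => coefs f 1)) /eqP; rewrite /= oner_eq0.
Qed.

(** The whole list of coefficients up to [n] is carried along, since each new coefficient of the
    inverse depends on all the earlier ones. *)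
Fixpoint inv_coefs f n : seq R :=
  if n is n'.+1 then
    let s := inv_coefs f n' in
    rcons s (- (coefs f 0)^-1 * \sum_(i < n) coefs f i.+1 * s`_(n' - i))
  else [:: (coefs f 0)^-1].

Lemma size_inv_coefs f n : size (inv_coefs f n) = n.+1.
Proof. by elim: n => //= n IHn; rewrite size_rcons IHn. Qed.

Lemma inv_coefs_stable f n i :
  (i <= n)%N -> (inv_coefs f n)`_i = (inv_coefs f i)`_i.
Proof.
elim: n => [|n IHn]; first by rewrite leqn0 => /eqP ->.
rewrite leq_eqVlt => /predU1P[-> //|ltin].
by rewrite /= nth_rcons size_inv_coefs ltin IHn.
Qed.

(** Solving [f * g = 1] coefficient by coefficient divides only by the constant term of [f]. *)
Lemma fps_unit_coefs0 f : coefs f 0 \is a GRing.unit -> f \is a GRing.unit.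
Proof.
move=> f0; pose g := Fps (fun n => (inv_coefs f n)`_n).
suff fg : f * g = 1 by apply/unitrP; exists g; rewrite mulrC.
apply: fpsP => -[|n]; first by rewrite coefsM0 /= divrr.
rewrite coefsM big_ord_recl coefs1 subn0 /= nth_rcons size_inv_coefs ltnn eqxx.
rewrite mulrA mulrN divrr // mulN1r addrC; apply/eqP; rewrite subr_eq0.
apply/eqP/eq_bigr => i _.
by rewrite /bump leq0n add1n subSS (inv_coefs_stable _ _ _ (leq_subr i n)).
Qed.

End FpsExtra.

(** * Removing the last step, and the resulting recurrence for [MQ] *)

Lemma vertex_rcons p e k :
  (k <= size p)%N -> vertex (rcons p e) k = vertex p k.
Proof. by move=> le_kp; rewrite /vertex -cats1 takel_cat. Qed.

Lemma endpoint_rcons p e : endpoint (rcons p e) = endpoint p + e.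
Proof.
by rewrite /endpoint /vertex !take_size -cats1 big_cat big_seq1.
Qed.

(** Appending a step keeps the old vertices, so only the new endpoint needs a check. *)
Lemma is_motzkin_rcons p e : is_motzkin (rcons p e) =
  [&& is_motzkin p, e \in motzkin_steps & 0 <= (endpoint (rcons p e)).2].
Proof.
have iotaS k : iota 0 k.+1 = rcons (iota 0 k) k by rewrite -addn1 iotaD cats1.
rewrite /is_motzkin /endpoint !all_rcons size_rcons iotaS all_rcons.
have -> : all (fun k => 0 <= (vertex (rcons p e) k).2) (iota 0 (size p).+1)
        = all (fun k => 0 <= (vertex p k).2) (iota 0 (size p).+1).
  by apply: eq_in_all => k; rewrite mem_iota ltnS => kp; rewrite vertex_rcons.
by rewrite -!andbA; do !bool_congr.
Qed.

Lemma avoids_odd_flat_rcons p e : avoids_odd_flat (rcons p e) =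
  avoids_odd_flat p && (odd (size p) ==> (e != flat_step)).
Proof.
rewrite /avoids_odd_flat size_rcons -addn1 iotaD all_cat /= andbT add0n.
rewrite nth_rcons ltnn eqxx; congr (_ && _); apply: eq_in_all => i.
by rewrite mem_iota add0n nth_rcons => /andP[_ ->].
Qed.

Lemma endpoint_ge0 p : is_motzkin p -> 0 <= (endpoint p).2.
Proof.
by case/andP=> _ /allP; apply; rewrite mem_iota ltnSn.
Qed.

(** The last of [n.+1] steps has index [n], so it can be flat only for even [n]. The guard [0 < m]
    excludes the truncated value [0.-1 = 0]. *)
Lemma is_MQ_path_rcons n m p e : is_MQ_path n.+1 m (rcons p e) =
  [|| [&& e == (1, 0), ~~ odd n & is_MQ_path n m p],
      (e == (1, -1)) && is_MQ_path n m.+1 p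
    | [&& e == (1, 1), (0 < m)%N & is_MQ_path n m.-1 p]].
Proof.
have szE k : is_MQ_path n k p -> size p = n by exact: is_MQ_path_size.
rewrite /is_MQ_path is_motzkin_rcons avoids_odd_flat_rcons endpoint_rcons.
apply/idP/idP.
  move=> pP; have szp : size p = n.
    have := @is_MQ_path_size n.+1 m (rcons p e).
    rewrite /is_MQ_path is_motzkin_rcons avoids_odd_flat_rcons endpoint_rcons.
    by rewrite pP size_rcons => /(_ isT) [].
  case/and3P: pP => /and3P[pM eS e0] /eqP pe /andP[pA pe_odd].
  (* The height before the last step is nonnegative, which forces [0 < m] after an up step. *)
  have := endpoint_ge0 _ pM; rewrite pM pA andbT /=.
  move: pe; rewrite (surjective_pairing (endpoint p)).
  move: eS pe_odd; rewrite szp !inE => /or3P[] /eqP -> /= pe_odd [] p1 p2 p0.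
  - by rewrite -[~~ _]implybF pe_odd xpair_eqE; lia.
  - by rewrite xpair_eqE; lia.
  - by rewrite xpair_eqE; lia.
case/or3P.
- case/and3P=> /eqP -> nodd pP; have szp := szE _ pP.
  case/and3P: pP => -> /eqP -> ->; rewrite szp implybF nodd /= !andbT.
  by rewrite xpair_eqE /=; lia.
- case/andP=> /eqP -> pP; have szp := szE _ pP.
  case/and3P: pP => -> /eqP -> ->; rewrite szp implybT /= !andbT.
  by rewrite xpair_eqE /=; lia.
- case/and3P=> /eqP -> m0 pP; have szp := szE _ pP.
  case/and3P: pP => -> /eqP -> ->; rewrite szp implybT /= !andbT.
  by rewrite xpair_eqE /=; lia.
Qed.

(** An explicit list built by last step: its length visibly satisfies the recurrence that the
    cardinal [MQ] hides. *)
Fixpoint MQ_paths (n m : nat) : seq lattice_path :=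
  if n is n'.+1 then
    (if odd n' then [::] else [seq rcons p (1, 0) | p <- MQ_paths n' m]) ++
    [seq rcons p (1, -1) | p <- MQ_paths n' m.+1] ++
    (if m is m'.+1 then [seq rcons p (1, 1) | p <- MQ_paths n' m'] else [::])
  else if m is 0 then [:: [::]] else [::].

Lemma mem_map_rcons (s : seq lattice_path) p e d :
  (rcons p e \in [seq rcons q d | q <- s]) = (e == d) && (p \in s).
Proof.
apply/mapP/andP => [[q qs /rcons_inj[-> ->]]|[/eqP -> ps]]; first by [].
by exists p.
Qed.

Lemma mem_MQ_paths n m p : (p \in MQ_paths n m) = is_MQ_path n m p.
Proof.
elim: n m p => [|n IHn] m p.
  apply/idP/idP => [|pP].
    by case: m => //; rewrite inE => /eqP ->; rewrite /is_MQ_path /endpoint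
      /vertex /is_motzkin /= /vertex !big_nil.
  have /size0nil p0 := is_MQ_path_size pP; move: pP; rewrite p0.
  by case/and3P=> _; rewrite /endpoint /vertex big_nil; case: m.
case/lastP: p => [|p e].
  have -> : is_MQ_path n.+1 m [::] = false.
    by apply/negP => /is_MQ_path_size.
  apply/negP; rewrite /= !mem_cat => /or3P[].
  - by case: odd => // /mapP[[]].
  - by move=> /mapP[[]].
  - by case: m => // m /mapP[[]].
rewrite is_MQ_path_rcons /= !mem_cat mem_map_rcons IHn; congr [|| _, _ | _].
  by case: odd; rewrite ?andbF // mem_map_rcons IHn.
by case: m => [|m]; rewrite ?andbF // mem_map_rcons IHn.
Qed.

(** The three blocks are disjoint because their paths end in different steps. *)
Lemma uniq_MQ_paths n m : uniq (MQ_paths n m).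
Proof.
elim: n m => [|n IHn] m; first by case: m.
have um d k : uniq [seq rcons p d | p <- MQ_paths n k].
  by rewrite map_inj_uniq // => p q /rcons_inj[].
have disj d d' (s s' : seq lattice_path) : d != d' ->
    ~~ has (mem [seq rcons p d | p <- s]) [seq rcons p d' | p <- s'].
  move=> dd'; apply/hasPn => _ /mapP[p _ ->] /=.
  by rewrite mem_map_rcons eq_sym (negPf dd').
rewrite /= !cat_uniq um has_cat negb_or.
by case: odd; case: m => [|m]; rewrite ?um ?disj //= ?has_pred0.
Qed.

Lemma MQ_size n m : MQ n m = size (MQ_paths n m).
Proof.
have [s [us sP <-]] := MQP n m.
apply/perm_size/uniq_perm => // [|p]; first exact: uniq_MQ_paths.
by rewrite sP mem_MQ_paths.
Qed.

Lemma MQ0 m : MQ 0 m = (m == 0)%N.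
Proof. by rewrite MQ_size; case: m. Qed.

Lemma MQS n m : MQ n.+1 m =
  ((if odd n then 0 else MQ n m) + MQ n m.+1
   + (if m is m'.+1 then MQ n m' else 0))%N.
Proof.
rewrite !MQ_size /= !size_cat size_map addnA; congr (_ + _ + _)%N.
  by case: odd; rewrite ?size_map.
by case: m => // m; rewrite size_map MQ_size.
Qed.

(** * Symmetric functions of the small roots of the kernel *)

Section KernelRelations.
Variables (A : idomainType) (x r r1 r2 u1 u2 : A).
Hypothesis two_neq0 : 2 != 0 :> A.
Hypotheses (r_sqr : r ^+ 2 = 4 + x ^+ 2)
  (r1_sqr : r1 ^+ 2 = 4 - 14 * x ^+ 2 - 2 * x * r)
  (r2_sqr : r2 ^+ 2 = 4 - 14 * x ^+ 2 + 2 * x * r)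
  (u1E : u1 * (- x + r + r1) = 4) (u2E : u2 * (- x - r - r2) = 4).

Let four_neq0 : 4 != 0 :> A.
Proof. by rewrite (_ : 4 = 2 * 2); [rewrite mulf_neq0 | ring]. Qed.

(** Rationalization: [(r - x)^2 - r1^2 = 16 x^2]. Hence [x * u1] is the root [q1] of the statement,
    written without division by [x]. *)
Lemma kernel_root1 : 4 * x ^+ 2 * u1 = - x + r - r1.
Proof.
apply: (mulIf (_ : - x + r + r1 != 0)).
  by apply: contraTneq four_neq0 => a0; rewrite negbK -u1E a0 mulr0.
rewrite -mulrA u1E; transitivity ((r - x) ^+ 2 - r1 ^+ 2); last by ring.
by rewrite r1_sqr sqrrB r_sqr; ring.
Qed.

Lemma kernel_root2 : 4 * x ^+ 2 * u2 = - x - r + r2.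
Proof.
apply: (mulIf (_ : - x - r - r2 != 0)).
  by apply: contraTneq four_neq0 => a0; rewrite negbK -u2E a0 mulr0.
rewrite -mulrA u2E; transitivity ((r + x) ^+ 2 - r2 ^+ 2); last by ring.
by rewrite r2_sqr sqrrD r_sqr; ring.
Qed.

(** With [t = y + 1/y] the kernel equation becomes [x^2 (t^2 + t) = 1], with roots
    [(- x + r) / (2 x)] and [(- x - r) / (2 x)]. This says that [q1] belongs to the first value of
    [t]; [quad2] says that [q2] belongs to the second. *)
Let quad1 : 2 * (1 + (x * u1) ^+ 2) = (r - x) * u1.
Proof.
apply: (mulfI two_neq0); transitivity (4 + 4 * x ^+ 2 * u1 * u1); first by ring.
by rewrite kernel_root1 -[X in X + _]u1E; ring.
Qed.

Let quad2 : 2 * (1 + (x * u2) ^+ 2) = - (r + x) * u2.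
Proof.
apply: (mulfI two_neq0); transitivity (4 + 4 * x ^+ 2 * u2 * u2); first by ring.
by rewrite kernel_root2 -[X in X + _]u2E; ring.
Qed.

(** The two values of [t] have sum [-1]; denominators are cleared. *)
Lemma kernel_roots_sum (q1 := x * u1) (q2 := x * u2) :
  q1 + q2 + q1 * q2 + q1 * q2 * (q1 + q2) = 0.
Proof.
apply: (mulfI two_neq0); rewrite /q1 /q2 mulr0.
transitivity (x * u1 * (2 * (1 + (x * u2) ^+ 2))
  + x * u2 * (2 * (1 + (x * u1) ^+ 2)) + 2 * (x * u1) * (x * u2)).
  by ring.
by rewrite quad1 quad2; ring.
Qed.

(** The two values of [t] have product [- 1 / x^2], and
    [(1 + q1^2) (1 + q2^2) = (1 - Q)^2 + S^2]. *)
Lemma kernel_roots_prod (q1 := x * u1) (q2 := x * u2) :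
  - (u1 * u2) = (1 - q1 * q2) ^+ 2 + (q1 + q2) ^+ 2.
Proof.
apply: (mulfI four_neq0); rewrite /q1 /q2.
transitivity (2 * (1 + (x * u1) ^+ 2) * (2 * (1 + (x * u2) ^+ 2))); last by ring.
rewrite quad1 quad2; transitivity ((x ^+ 2 - r ^+ 2) * (u1 * u2)); last by ring.
by rewrite r_sqr; ring.
Qed.

End KernelRelations.

(* The identities behind [E = c h] and [O = x (1 + S + (1 - Q) y) E], where
   [h] stands for [1 / ((1 - q1 y) (1 - q2 y))]. *)
Section SystemIdentities.
Variables (A : idomainType) (x S Q c : A).
Hypotheses (Q_neq1 : 1 - Q != 0) (SQ : S + Q + Q * S = 0)
  (QE : - Q = x ^+ 2 * ((1 - Q) ^+ 2 + S ^+ 2))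
  (cE : c * (1 - Q) = (1 - Q) ^+ 2 + S ^+ 2).

Lemma constant_term_Q : x ^+ 2 * c * (1 - Q) = - Q.
Proof. by rewrite -mulrA cE -QE. Qed.

Let QS : - Q * (1 + S) = S.
Proof. by rewrite -[RHS]subr0 -SQ; ring. Qed.

Lemma constant_term_S : x ^+ 2 * c * (1 - Q) * (1 + S) = S.
Proof. by rewrite constant_term_Q QS. Qed.

Lemma constant_term : c = 1 + x ^+ 2 * c * (1 - Q) + x ^+ 2 * c * (1 + S) * S.
Proof.
apply: (mulIf Q_neq1); rewrite cE.
transitivity ((1 - Q) + x ^+ 2 * c * (1 - Q) * (1 - Q)
   + x ^+ 2 * c * (1 - Q) * (1 + S) * S); last by ring.
by rewrite constant_term_S constant_term_Q; ring.
Qed.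

(** The equation for [E], multiplied by [1 / h]. The three facts on [c] above match the coefficients
    of [y], [y^2] and [y^3]. *)
Lemma even_equation y : c * y =
  y * (1 - S * y + Q * y ^+ 2)
  + x ^+ 2 * c * ((1 + y * y) * (1 + S + (1 - Q) * y)
                  - (1 + S) * (1 - S * y + Q * y ^+ 2)).
Proof.
transitivity ((1 + x ^+ 2 * c * (1 - Q) + x ^+ 2 * c * (1 + S) * S) * y
   + (x ^+ 2 * c * (1 - Q) * (1 + S) - S) * y ^+ 2
   + (Q + x ^+ 2 * c * (1 - Q)) * y ^+ 3); last by ring.
by rewrite -constant_term constant_term_S constant_term_Q; ring.
Qed.

(** The kernel is palindromic in [y], so its roots are [q1], [q2] and their inverses; the two
    factors collect the small and the large ones. *)
Lemma kernel_factorization y :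
  c * (1 - Q) * (y ^+ 2 - x ^+ 2 * (1 + y ^+ 2) * (1 + y + y ^+ 2))
  = (y ^+ 2 - S * y + Q) * (1 - S * y + Q * y ^+ 2).
Proof.
rewrite cE; transitivity (((1 - Q) ^+ 2 + S ^+ 2) * y ^+ 2
  - x ^+ 2 * ((1 - Q) ^+ 2 + S ^+ 2) * ((1 + y ^+ 2) * (1 + y + y ^+ 2))).
  by ring.
rewrite -QE; apply/eqP; rewrite -subr_eq0; apply/eqP.
by rewrite -[RHS](mul0r (y + y ^+ 3)) -SQ; ring.
Qed.

(** This turns the contribution of [O] to the numerator into the form of the statement; the
    difference of the sides is a combination of [SQ] and [QE]. *)
Lemma numerator_equation y :
  x ^+ 2 * (y ^+ 2 - S * y + Q) * (1 + S + (1 - Q) * y)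
  = Q * y - x ^+ 2 * (S - y + Q * y) * (1 + y + y ^+ 2).
Proof.
apply/eqP; rewrite -subr_eq0; apply/eqP.
transitivity ((S + Q + Q * S) * (x ^+ 2 * (1 + y ^+ 2))
  - (Q + x ^+ 2 * ((1 - Q) ^+ 2 + S ^+ 2)) * y); first by ring.
by rewrite SQ -QE; ring.
Qed.

End SystemIdentities.

(** * Carrying identities without denominators into a field *)

Lemma root_quotient (F : fieldType) (x a u : F) :
  4 * x != 0 -> 4 * x ^+ 2 * u = - a -> - (a / (4 * x)) = x * u.
Proof.
move=> x4_neq0 e; apply: (mulIf x4_neq0); rewrite mulNr divfK // -e; ring.
Qed.

(** Injectivity of [f] keeps the denominator nonzero, so an identity proved in the ring [A] yields
    the quotient in [F]. *)
Lemma rmorph_kernel_quotient (A : idomainType) (F : fieldType)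
    (f : {rmorphism A -> F}) (M x y q1 q2 : A) :
    injective f -> x != 0 -> 1 - q1 * q2 != 0 ->
    y ^+ 2 - x ^+ 2 * (1 + y ^+ 2) * (1 + y + y ^+ 2) != 0 ->
    M * (x * (1 - q1 * q2)
      * (y ^+ 2 - x ^+ 2 * (1 + y ^+ 2) * (1 + y + y ^+ 2)))
    = x * (y ^+ 2 - (q1 + q2) * y + q1 * q2) + q1 * q2 * y
      - x ^+ 2 * (q1 + q2 - y + q1 * q2 * y) * (1 + y + y ^+ 2) ->
  f M = (f x * (f q1 - f y) * (f q2 - f y) + f q1 * f q2 * f y
      - f x ^+ 2 * (f q1 + f q2 - f y + f q1 * f q2 * f y)
        * (1 + f y + f y ^+ 2))
    / (f x * (1 - f q1 * f q2)
        * (f y ^+ 2 - f x ^+ 2 * (1 + f y ^+ 2) * (1 + f y + f y ^+ 2))).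
Proof.
move=> f_inj x_neq0 D_neq0 K_neq0 e.
set num := (X in _ = X / _); set den := (X in _ = _ / X).
have denE : den = f (x * (1 - q1 * q2)
    * (y ^+ 2 - x ^+ 2 * (1 + y ^+ 2) * (1 + y + y ^+ 2))).
  by rewrite !(rmorphM, rmorphB, rmorphD, rmorph1, rmorphXn).
apply: (canRL (mulfK _)).
  by rewrite denE raddf_eq0 // !mulf_neq0.
rewrite denE -rmorphM e.
by rewrite !(rmorphM, rmorphB, rmorphD, rmorph1, rmorphXn) /num; ring.
Qed.

Lemma rmorph_axis_quotient (A : idomainType) (F : fieldType)
    (f : {rmorphism A -> F}) (M x q1 q2 : A) :
    injective f -> x != 0 -> 1 - q1 * q2 != 0 ->
    M * (x ^+ 2 * (1 - q1 * q2)) = x * (q1 + q2) - q1 * q2 ->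
  f M = (f x * (f q1 + f q2) - f q1 * f q2)
    / (f x ^+ 2 * (1 - f q1 * f q2)).
Proof.
move=> f_inj x_neq0 D_neq0 e.
set den := (X in _ = _ / X).
have denE : den = f (x ^+ 2 * (1 - q1 * q2)).
  by rewrite !(rmorphM, rmorphB, rmorph1, rmorphXn).
apply: (canRL (mulfK _)); first by rewrite denE raddf_eq0 // !mulf_neq0.
by rewrite denE -rmorphM e !(rmorphM, rmorphB, rmorphD).
Qed.

(** * Solving the functional system in power series *)

Section Solution.
Local Notation X := (fpsX rat).
Local Notation Y := (fpsX (fps rat)).

Lemma MQ_series_unique (E O : fps (fps rat)) :
    Y * E = Y + fpsC X * ((1 + Y * Y) * O - fpsC (coefs O 0)) ->
    Y * O = fpsC X * ((1 + Y + Y * Y) * E - fpsC (coefs E 0)) ->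
  Fps (fun m => Fps (fun n => (MQ n m)%:R)) = E + O.
Proof.
move=> eqE eqO.
(* The coefficient of [y^(m+1)] in the equation gives that of [y^m] in [E], with a factor [X] in
   front. *)
have recE m : coefs E m = (m == 0%N)%:R
    + X * (coefs O m.+1 + (if m is m'.+1 then coefs O m' else 0)).
  rewrite -(coefs_fpsXMS _ E) eqE coefsD coefs_fpsCM coefsD coefsN mulrDl mul1r.
  rewrite -mulrA coefsD coefs_fpsXMS subr0; congr (_ + X * (_ + _)).
  by case: m => [|m]; rewrite ?coefs_fpsXM0 ?coefs_fpsXMS.
have recO m : coefs O m =
    X * (coefs E m.+1 + coefs E m + (if m is m'.+1 then coefs E m' else 0)).
  rewrite -(coefs_fpsXMS _ O) eqO coefs_fpsCM coefsD coefsN !mulrDl mul1r.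
  rewrite -mulrA !coefsD !coefs_fpsXMS subr0; congr (X * (_ + _)).
  by case: m => [|m]; rewrite ?coefs_fpsXM0 ?coefs_fpsXMS.
(* Thanks to that factor, induction on the exponent of [x] works: [E] carries the even powers and
   [O] the odd ones. *)
have EO n : (forall m, coefs (coefs E m) n = if odd n then 0 else (MQ n m)%:R)
    /\ (forall m, coefs (coefs O m) n = if odd n then (MQ n m)%:R else 0).
  elim: n => [|n [IHE IHO]]; split=> m.
  - rewrite recE coefsD coefs_fpsXM0 addr0 MQ0.
    by case: m => [|m]; rewrite ?coefs0 ?coefs1.
  - by rewrite recO coefs_fpsXM0.
  - rewrite recE coefsD coefs_fpsXMS coefsD IHO MQS /=.
    have -> : coefs ((m == 0%N)%:R : fps rat) n.+1 = 0 by case: m.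
    case: m => [|m]; rewrite ?coefs0 ?IHO; case: odd; rewrite ?addr0 ?add0r //=.
      by rewrite addn0.
    by rewrite natrD.
  - rewrite recO coefs_fpsXMS !coefsD !IHE MQS /=.
    case: m => [|m]; rewrite ?coefs0 ?IHE; case: odd; rewrite ?addr0 //=.
      by rewrite addn0 natrD addrC.
    by rewrite !natrD [_ + (MQ n m.+1)%:R]addrC.
apply: fpsP => m; apply: fpsP => n; have [HE HO] := EO n.
transitivity (coefs (coefs E m) n + coefs (coefs O m) n); last by [].
by rewrite HE HO /=; case: odd; rewrite ?add0r ?addr0.
Qed.

Section RationalForm.
Variables u1 u2 : fps rat.
Local Notation S := (X * u1 + X * u2).
Local Notation Q := (X * u1 * (X * u2)).
Hypotheses (SQ : S + Q + Q * S = 0)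
  (uE : - (u1 * u2) = (1 - Q) ^+ 2 + S ^+ 2).

Lemma one_subQ_unit : 1 - Q \is a GRing.unit.
Proof.
apply: fps_unit_coefs0.
by rewrite coefsD coefsN coefs1 -mulrA coefs_fpsXM0 subr0 unitr1.
Qed.

Lemma prod_rootsE : - Q = X ^+ 2 * ((1 - Q) ^+ 2 + S ^+ 2).
Proof. by rewrite -uE; ring. Qed.

(** By [uE] this is [- u1 u2 / (1 - Q)], the constant term in [y] of [E]. *)
Definition MQ_c : fps rat := ((1 - Q) ^+ 2 + S ^+ 2) / (1 - Q).

Lemma MQ_cE : MQ_c * (1 - Q) = (1 - Q) ^+ 2 + S ^+ 2.
Proof. by rewrite divrK ?one_subQ_unit. Qed.

Lemma one_subQ_neq0 : 1 - Q != 0.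
Proof. by apply: contraTneq one_subQ_unit => ->; rewrite unitr0. Qed.

Local Notation C := (@fpsC (fps rat)).

(** The identities above need [x] and [y] in one domain, so the relations are pushed into
    Q[[x]][[y]]. *)
Let SQ_C : C S + C Q + C Q * C S = 0.
Proof. by rewrite -rmorphM -!rmorphD SQ rmorph0. Qed.

Let QE_C : - C Q = C X ^+ 2 * ((1 - C Q) ^+ 2 + C S ^+ 2).
Proof.
transitivity (C (- Q)); first by rewrite rmorphN.
by rewrite prod_rootsE rmorphM rmorphD !rmorphXn rmorphB rmorph1.
Qed.

Let cE_C : C MQ_c * (1 - C Q) = (1 - C Q) ^+ 2 + C S ^+ 2.
Proof.
transitivity (C (MQ_c * (1 - Q))); first by rewrite [RHS]rmorphM rmorphB rmorph1.
by rewrite MQ_cE rmorphD !rmorphXn rmorphB rmorph1.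
Qed.

Lemma one_subQ_neq0_C : 1 - C Q != 0.
Proof.
have -> : 1 - C Q = C (1 - Q) by rewrite rmorphB rmorph1.
apply: contra one_subQ_neq0 => /eqP CQ0; apply/eqP/(@fpsC_inj (fps rat)).
by rewrite CQ0 rmorph0.
Qed.

Definition MQ_den : fps (fps rat) := 1 - C S * Y + C Q * Y ^+ 2.

Lemma MQ_den0 : coefs MQ_den 0 = 1.
Proof.
rewrite /MQ_den 2!coefsD coefsN coefs1 !coefs_fpsCM expr2 coefs_fpsXM0.
by rewrite !mulr0 subr0 addr0.
Qed.

Lemma MQ_den_unit : MQ_den \is a GRing.unit.
Proof. by apply: fps_unit_coefs0; rewrite MQ_den0 unitr1. Qed.

Lemma MQ_den_inv0 : coefs MQ_den^-1 0 = 1.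
Proof.
have /(congr1 (fun f => coefs f 0)) := divrr MQ_den_unit.
by rewrite coefsM0 MQ_den0 mul1r coefs1.
Qed.

Definition MQ_even : fps (fps rat) := C MQ_c * MQ_den^-1.
Definition MQ_odd : fps (fps rat) := C X * (1 + C S + (1 - C Q) * Y) * MQ_even.

Lemma MQ_even0 : coefs MQ_even 0 = MQ_c.
Proof. by rewrite coefs_fpsCM MQ_den_inv0 mulr1. Qed.

Lemma MQ_odd0 : coefs MQ_odd 0 = X * (1 + S) * MQ_c.
Proof.
rewrite coefsM0 MQ_even0 coefs_fpsCM 2!coefsD mulrC [_ * Y]mulrC coefs_fpsXM0.
by rewrite addr0 coefs1 mulrC.
Qed.

Lemma MQ_seriesE :
  Fps (fun m => Fps (fun n => (MQ n m)%:R)) = MQ_even + MQ_odd.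
Proof.
apply: MQ_series_unique.
  apply: (mulIr MQ_den_unit).
  have -> : Y * MQ_even * MQ_den = C MQ_c * Y.
    by rewrite -mulrA divrK ?MQ_den_unit // mulrC.
  rewrite [LHS](even_equation _ _ _ _ _ one_subQ_neq0_C SQ_C QE_C cE_C) -/MQ_den.
  have -> : C (coefs MQ_odd 0) = C X * (1 + C S) * C MQ_c.
    by rewrite MQ_odd0 !rmorphM rmorphD rmorph1.
  transitivity (Y * MQ_den + C X * ((1 + Y * Y)
     * (C X * (1 + C S + (1 - C Q) * Y) * C MQ_c)
     - C X * (1 + C S) * C MQ_c * MQ_den)); first by ring.
  have -> : C MQ_c = MQ_even * MQ_den by rewrite divrK ?MQ_den_unit.
  by rewrite /MQ_odd; ring.
(* The equation for [O] reduces to [1 + y + y^2 - (1 - S y + Q y^2) = y (1 + S + (1 - Q) y)]. *)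
rewrite MQ_even0.
have -> : C MQ_c = MQ_even * MQ_den by rewrite divrK ?MQ_den_unit.
by rewrite /MQ_odd /MQ_den; ring.
Qed.

(** The factor [1 - S y + Q y^2] of the kernel cancels the denominator of [E], leaving
    [y^2 - S y + Q]. *)
Lemma MQ_series_kernel :
  (MQ_even + MQ_odd) * (C X * (1 - C Q)
    * (Y ^+ 2 - C X ^+ 2 * (1 + Y ^+ 2) * (1 + Y + Y ^+ 2)))
  = C X * (Y ^+ 2 - C S * Y + C Q) + C Q * Y
    - C X ^+ 2 * (C S - Y + C Q * Y) * (1 + Y + Y ^+ 2).
Proof.
have KE : MQ_even * (1 - C Q)
    * (Y ^+ 2 - C X ^+ 2 * (1 + Y ^+ 2) * (1 + Y + Y ^+ 2))
    = Y ^+ 2 - C S * Y + C Q.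
  apply: (mulIr MQ_den_unit).
  rewrite -[RHS](kernel_factorization _ _ _ _ _ SQ_C QE_C cE_C).
  have -> : C MQ_c = MQ_even * MQ_den by rewrite divrK ?MQ_den_unit.
  by ring.
rewrite -[RHS]addrA -(numerator_equation _ _ _ _ SQ_C QE_C) -KE /MQ_odd.
by ring.
Qed.

Lemma MQ_axisE :
  Fps (fun n => (MQ n 0)%:R) * (X ^+ 2 * (1 - Q)) = X * S - Q.
Proof.
have /(congr1 (fun f => coefs f 0)) := MQ_seriesE.
rewrite coefsD MQ_even0 MQ_odd0 /= => ->.
(* At [y = 0] the series is [c + x (1 + S) c]; both terms have known values once multiplied by
   [x^2 (1 - Q)]. *)
transitivity (X * (X ^+ 2 * MQ_c * (1 - Q) * (1 + S)) + X ^+ 2 * MQ_c * (1 - Q)).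
  by ring.
rewrite (constant_term_S _ _ _ _ _ SQ prod_rootsE MQ_cE).
by rewrite (constant_term_Q _ _ _ _ _ prod_rootsE MQ_cE).
Qed.

End RationalForm.

(** The constant term in [y] is [- x^2]. *)
Lemma kernel_poly_neq0 :
  Y ^+ 2 - fpsC X ^+ 2 * (1 + Y ^+ 2) * (1 + Y + Y ^+ 2) != 0.
Proof.
apply/eqP => /(congr1 (fun f => coefs f 0)) /eqP.
rewrite coefsD coefsN !coefsM0 !coefsD !expr2 !coefsM0 coefs0 coefs1 /=.
by rewrite !mul0r !addr0 sub0r !mulr1 oppr_eq0 mulf_eq0 orbb (negPf (fpsX_neq0 _)).
Qed.

Lemma coefs_nat0 k : coefs (k%:R : fps rat) 0 = k%:R.
Proof. by elim: k => // k IHk; rewrite -natr1 coefsD IHk coefs1 natr1. Qed.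

Lemma fps_nat_neq0 k : (k.+1%:R : fps rat) != 0.
Proof.
apply/eqP => /(congr1 (fun f => coefs f 0)) /eqP.
by rewrite coefs_nat0 coefs0 pnatr_eq0.
Qed.

End Solution.

(** * The square roots as series, and the passage to the fraction field *)

Theorem theorem18 :
  let X : fps rat := fpsX rat in
  let r : fps rat := fps_sqrt (4 + X ^+ 2) in
  let r1 : fps rat := fps_sqrt (4 - 14 * X ^+ 2 - 2 * X * r) in
  let r2 : fps rat := fps_sqrt (4 - 14 * X ^+ 2 + 2 * X * r) in
  let x : gfield := gfx in
  let y : gfield := gfy in
  let q1 : gfield := - ((x - gf_of_x r + gf_of_x r1) / (4 * x)) in
  let q2 : gfield := - ((x + gf_of_x r - gf_of_x r2) / (4 * x)) in
  MQ_gf =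
    (x * (q1 - y) * (q2 - y) + q1 * q2 * y
       - x ^+ 2 * (q1 + q2 - y + q1 * q2 * y) * (1 + y + y ^+ 2))
    / (x * (1 - q1 * q2)
         * (y ^+ 2 - x ^+ 2 * (1 + y ^+ 2) * (1 + y + y ^+ 2)))
  /\
  MQ_axis_gf =
    (x * (q1 + q2) - q1 * q2) / (x ^+ 2 * (1 - q1 * q2)).
Proof.
move=> X r r1 r2 x y q1 q2.
pose C : {rmorphism fps rat -> fps (fps rat)} := @fpsC (fps rat).
pose tofrac_xy : {rmorphism fps (fps rat) -> gfield} := @FracField.tofrac _.
have X0 g : coefs (X * g) 0 = 0 by exact: coefs_fpsXM0.
have [r_sqr r0] : r ^+ 2 = 4 + X ^+ 2 /\ coefs r 0 = 2.
  by apply: fps_sqrtP => //; rewrite coefsD coefs_nat0 expr2 X0.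
have [r1_sqr r10] : r1 ^+ 2 = 4 - 14 * X ^+ 2 - 2 * X * r /\ coefs r1 0 = 2.
  apply: fps_sqrtP => //; rewrite 2!coefsD ?coefsN coefs_nat0.
  by rewrite [_ * X ^+ 2]mulrC expr2 [2 * X]mulrC -!mulrA !X0.
have [r2_sqr r20] : r2 ^+ 2 = 4 - 14 * X ^+ 2 + 2 * X * r /\ coefs r2 0 = 2.
  apply: fps_sqrtP => //; rewrite 2!coefsD ?coefsN coefs_nat0.
  by rewrite [_ * X ^+ 2]mulrC expr2 [2 * X]mulrC -!mulrA !X0.
(* All three square roots have constant term 2, so these denominators have constant terms 4 and
   -4. *)
have a1_unit : - X + r + r1 \is a GRing.unit.
  by apply: fps_unit_coefs0; rewrite 2!coefsD coefsN r0 r10.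
have a2_unit : - X - r - r2 \is a GRing.unit.
  by apply: fps_unit_coefs0; rewrite 2!coefsD !coefsN r0 r20.
pose u1 := 4 / (- X + r + r1); pose u2 := 4 / (- X - r - r2).
have u1E : u1 * (- X + r + r1) = 4 by rewrite divrK.
have u2E : u2 * (- X - r - r2) = 4 by rewrite divrK.
have two_neq0 : 2 != 0 :> fps rat := fps_nat_neq0 1.
have SQ : X * u1 + X * u2 + X * u1 * (X * u2)
    + X * u1 * (X * u2) * (X * u1 + X * u2) = 0.
  exact: kernel_roots_sum r_sqr r1_sqr r2_sqr u1E u2E.
have uE : - (u1 * u2) = (1 - X * u1 * (X * u2)) ^+ 2 + (X * u1 + X * u2) ^+ 2.
  exact: kernel_roots_prod r_sqr r1_sqr r2_sqr u1E u2E.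
have CS : C (X * u1 + X * u2) = C (X * u1) + C (X * u2) by rewrite rmorphD.
have CQ : C (X * u1 * (X * u2)) = C (X * u1) * C (X * u2) by rewrite rmorphM.
have D_neq0 := one_subQ_neq0_C u1 u2.
have e := MQ_series_kernel u1 u2 SQ uE; rewrite -(MQ_seriesE u1 u2 SQ uE) in e.
have eX := MQ_axisE u1 u2 SQ uE.
rewrite CS CQ in e; rewrite CQ in D_neq0.
have CX_neq0 : C X != 0.
  by rewrite -(rmorph0 C) (inj_eq (@fpsC_inj _)) fpsX_neq0.
pose phi : {rmorphism fps rat -> gfield} := tofrac_xy \o C.
have x4_neq0 : 4 * x != 0.
  rewrite -(rmorph_nat phi) -(rmorphM phi) -(rmorph0 phi).
  by rewrite (inj_eq gf_of_x_inj) mulf_neq0 ?fps_nat_neq0 ?fpsX_neq0.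
have q1E : q1 = phi (X * u1).
  rewrite rmorphM; apply: root_quotient x4_neq0 _.
  have /(congr1 phi) := kernel_root1 _ _ _ _ _ two_neq0 r_sqr r1_sqr u1E.
  rewrite 2!rmorphM rmorph_nat rmorphXn 2!rmorphD !rmorphN => ->.
  by rewrite !opprD opprK.
have q2E : q2 = phi (X * u2).
  rewrite rmorphM; apply: root_quotient x4_neq0 _.
  have /(congr1 phi) := kernel_root2 _ _ _ _ _ two_neq0 r_sqr r2_sqr u2E.
  rewrite 2!rmorphM rmorph_nat rmorphXn 2!rmorphD !rmorphN => ->.
  by rewrite !opprD opprK.
rewrite q1E q2E; split.
  exact: (rmorph_kernel_quotient _ _ tofrac_xy _ _ _ _ _ gf_of_xy_inj CX_neq0
    D_neq0 kernel_poly_neq0 e).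
exact: (rmorph_axis_quotient _ _ phi _ _ _ _ gf_of_x_inj (fpsX_neq0 _)
  (one_subQ_neq0 u1 u2) eX).
Qed.
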